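(* Let $r \geq 3$. There is $n_0 = n_0(r)$ such that for all $n \geq n_0$ and every non-empty subset $X \subseteq [2,n]$ the following hold. (a) If $X=\{2\}$ then $\mathcal{AHM}_3$ is optimal for $X$. (b) If $|X|=2$ and $X \cap \{2,3\}\neq \emptyset$ then $\mathcal{AHM}_3$ is optimal for $X$. Furthermore, if also $4 \in X$, then $\mathcal{AHM}_4$ is simultaneously optimal for $X$. (c) If $|X|=3$ and $\{2,3\} \subseteq X$ then $\mathcal{AHM}_3$ is optimal for $X$. Furthermore, if also $X=\{2,3,4\}$, then $\mathcal{AHM}_4$ is simultaneously optimal for $X$. (d) If $X \subseteq [2,r+1]$ and $X$ is not as in (a)--(c), then $\mathcal{AHM}_m$ is optimal for $X$, where $m := \max X$. No other MLCIFs are optimal for $X$ as in (a)--(d), and for every other non-empty $X \subseteq [2,n]$ the star $\mathcal{S}$ is the unique optimal MLCIF for $X$.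
   Context: For integers $a\le b$, $[b]=\{1,\dots,b\}$ and $[a,b]=\{a,\dots,b\}$ (empty if $a>b$); $\binom{Y}{r}$ is the family of $r$-element subsets of $Y$. A family $\mathcal{A}\subseteq\binom{[n]}{r}$ is intersecting if no two members are disjoint. For $A=\{a_1<\dots<a_r\}$, $B=\{b_1<\dots<b_r\}$ write $B\le A$ if $b_i\le a_i$ for all $i$; $\mathcal{A}$ is left-compressed if $A\in\mathcal{A}$ and $B\le A$ imply $B\in\mathcal{A}$. An MLCIF is a left-compressed intersecting family in $\binom{[n]}{r}$ that is maximal (under inclusion) among left-compressed intersecting families in $\binom{[n]}{r}$. For $X\subseteq[n]$, $\mathrm{hit}_X(\mathcal{A})=|\{A\in\mathcal{A}: A\cap X\neq\emptyset\}|$. An MLCIF $\mathcal{A}$ is optimal for $X$ if $\mathrm{hit}_X(\mathcal{A})\ge \mathrm{hit}_X(\mathcal{F})$ for every MLCIF $\mathcal{F}\subseteq\binom{[n]}{r}$. The star is $\mathcal{S}=\{A\in\binom{[n]}{r}:1\in A\}$. For $t\in[n]$, the $t$-adjusted Hilton–Milner family is $\mathcal{AHM}_t=\{A\in\mathcal{S}: A\cap[2,t]\ne\emptyset\}\cup\{A\in\binom{[n]}{r}:[2,t]\subseteq A\}$. *)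

(* Defs.v *)
From HB Require Import structures.
From mathcomp Require Import all_boot all_order.

Set Implicit Arguments.
Unset Strict Implicit.
Unset Printing Implicit Defensive.

(* The ground set [n] = {1, ..., n} lives in 'I_n.+1, so that an element has
   its own value; the extra point 0 is excluded by [uniform], the family of
   r-element subsets of [n]. *)

Definition itv (n a b : nat) : {set 'I_n.+1} := [set i : 'I_n.+1 | a <= i <= b].

Definition uniform (n r : nat) : {set {set 'I_n.+1}} :=
  [set A : {set 'I_n.+1} | (A \subset itv n 1 n) && (#|A| == r)].

Definition intersecting (n : nat) (F : {set {set 'I_n.+1}}) : Prop :=
  forall A B, A \in F -> B \in F -> ~~ [disjoint A & B].

Definition elems (n : nat) (A : {set 'I_n.+1}) : seq nat :=
  [seq val i | i <- enum A].

Lemma elems_sorted (n : nat) (A : {set 'I_n.+1}) : sorted ltn (elems A).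
Proof.
rewrite /elems {1}/enum_mem -enumT.
apply: (subseq_sorted ltn_trans _ (iota_ltn_sorted 0 n.+1)).
by rewrite -val_enum_ord; apply: map_subseq; apply: filter_subseq.
Qed.

(* [all2] also requires both lists to have the same length. *)
Definition set_le (n : nat) (B A : {set 'I_n.+1}) : bool :=
  all2 leq (elems B) (elems A).

Definition left_compressed (n r : nat) (F : {set {set 'I_n.+1}}) : Prop :=
  forall A B, A \in F -> B \in uniform n r -> set_le B A -> B \in F.

Definition LCIF (n r : nat) (F : {set {set 'I_n.+1}}) : Prop :=
  [/\ F \subset uniform n r, left_compressed r F & intersecting F].

Definition MLCIF (n r : nat) (F : {set {set 'I_n.+1}}) : Prop :=
  LCIF r F /\ (forall G, LCIF r G -> F \subset G -> G = F).

Definition hit (n : nat) (X : {set 'I_n.+1}) (F : {set {set 'I_n.+1}}) : nat :=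
  #|[set A in F | A :&: X != set0]|.

Definition optimal (n r : nat) (X : {set 'I_n.+1}) (F : {set {set 'I_n.+1}}) :
    Prop :=
  MLCIF r F /\ (forall G, MLCIF r G -> hit X G <= hit X F).

Definition star (n r : nat) : {set {set 'I_n.+1}} :=
  [set A in uniform n r | inord 1 \in A].

Definition AHM (n r t : nat) : {set {set 'I_n.+1}} :=
  [set A in star n r | A :&: itv n 2 t != set0]
  :|: [set A in uniform n r | itv n 2 t \subset A].

(* [inord k] is the element k of [n] as soon as k <= n. *)
Definition case_a (n : nat) (X : {set 'I_n.+1}) : Prop := X = [set inord 2].

Definition case_b (n : nat) (X : {set 'I_n.+1}) : Prop :=
  #|X| = 2 /\ X :&: [set inord 2; inord 3] != set0.

Definition case_c (n : nat) (X : {set 'I_n.+1}) : Prop :=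
  #|X| = 3 /\ [set inord 2; inord 3] \subset X.

Definition case_d (n r : nat) (X : {set 'I_n.+1}) : Prop :=
  [/\ X \subset itv n 2 r.+1, ~ case_a X, ~ case_b X & ~ case_c X].

(* Main.v *)
Require Import Defs.
From HB Require Import structures.
From mathcomp Require Import all_boot all_order.
From mathcomp Require Import zify.

(** Write [D] for the binomial coefficient (n-2 choose r-2).  A maximal
    left-compressed intersecting family [F] is determined by the traces of its
    members on the window [[1, 2r]], because two members with disjoint traces
    could be compressed to complementary halves of the window.  If [F] is not
    the star then it contains [[2, r+1]], so every trace has at least two
    elements, and up to [O(D / n)] the family is counted by its traces of size
    two.  Either one of these avoids [1], which forces [F = AHM_3], or they are
    the pairs [{1, j}] for [2 <= j <= t].  To first order [X] is hit by [D] sets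
    for each such pair that meets [X]; the star reaches [|X| D], and for [F] to
    match it the pair [{1, max X}] must occur, in which case the members hitting
    [X] all lie in [AHM_m] with [m = max X].  The remaining comparisons between
    the star, [AHM_3] and [AHM_m] are exact binomial identities. *)

Set Implicit Arguments.
Unset Strict Implicit.
Unset Printing Implicit Defensive.

(** * Counting functions and the compression order *)

(** Sets of equal size are compared through this function of [k]: moving elements to the left
    amounts to increasing it pointwise, so compression arguments become inequalities between
    numbers. *)
Definition cnt (n : nat) (A : {set 'I_n.+1}) (k : nat) : nat :=
  #|[set i in A | (i : nat) <= k]|.

Lemma cntE n (A : {set 'I_n.+1}) k : cnt A k = count (leq^~ k) (elems A).
Proof.
rewrite /cnt /elems count_map cardE /enum_mem !size_filter count_filter.
by apply: eq_count => i; rewrite /= !inE andbC.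
Qed.

Lemma count_leq_all2 k (s t : seq nat) :
  all2 leq s t -> count (leq^~ k) t <= count (leq^~ k) s.
Proof.
elim: s t => [|x s IHs] [|y t] //= /andP[xy /IHs st].
by apply: leq_add => //; case: (leqP y k) => // /(leq_trans xy) ->.
Qed.

(** In a strictly increasing list the entries at most [k] form a prefix, whose length is the
    count. *)
Lemma sorted_count_nth (s : seq nat) k i :
  sorted ltn s -> i < size s -> (i < count (leq^~ k) s) = (nth 0 s i <= k).
Proof.
elim: s i => [|x s IHs] //= i pxs ilt.
have ss := path_sorted pxs.
have all_gt : all (ltn x) s by apply: order_path_min pxs; apply: ltn_trans.
have c0 : k < x -> count (leq^~ k) s = 0.
  move=> kx; apply/eqP; rewrite -leqn0 leqNgt -has_count; apply/hasPn => y ys /=.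
  by rewrite -ltnNge; apply: ltn_trans kx (allP all_gt _ ys).
case: i ilt => [|i] /= ilt; first by case: (leqP x k) => // /c0 ->.
case: (leqP x k) => xk; first by rewrite add1n ltnS IHs.
rewrite c0 //; apply/esym/negbTE; rewrite -ltnNge; apply: ltn_trans xk _.
by apply: (allP all_gt); apply: mem_nth.
Qed.

Lemma sorted_count_all2 (s t : seq nat) :
  sorted ltn s -> sorted ltn t -> size s = size t ->
  (forall k, count (leq^~ k) t <= count (leq^~ k) s) -> all2 leq s t.
Proof.
move=> ss st est dom; rewrite all2E est eqxx /=.
apply/(all_nthP (0, 0)) => i; rewrite size_zip est minnn => ilt.
rewrite nth_zip //= -sorted_count_nth ?est //.
by apply: leq_trans (dom _); rewrite sorted_count_nth.
Qed.

Lemma set_le_cnt n (A B : {set 'I_n.+1}) k : set_le B A -> cnt A k <= cnt B k.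
Proof. by rewrite !cntE; apply: count_leq_all2. Qed.

Lemma cnt_set_le n (A B : {set 'I_n.+1}) :
  #|A| = #|B| -> (forall k, cnt A k <= cnt B k) -> set_le B A.
Proof.
move=> eAB dom; apply: sorted_count_all2; rewrite ?elems_sorted //.
  by rewrite !size_map -!cardE.
by move=> k; rewrite -!cntE.
Qed.

Lemma card_itv n a b : b <= n -> #|itv n a b| = b.+1 - a.
Proof.
move=> bn; have [ab|ba] := leqP a b.+1; last first.
  rewrite (_ : itv n a b = set0) ?cards0; first by lia.
  by apply/setP=> i; rewrite !inE; lia.
rewrite -sum1dep_card -(big_mkord (fun i => a <= i <= b) (fun=> 1)).
rewrite sum1_count /index_iota subn0.
(* The index range is cut into the points below [a], the interval itself and the points above [b];
   only the middle piece contributes. *)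
have -> : n.+1 = a + ((b.+1 - a) + (n - b)) by lia.
rewrite !iotaD !count_cat !(@eq_in_count _ _ xpred0 (iota 0 a)); last first.
  by move=> i; rewrite mem_iota /=; lia.
rewrite (@eq_in_count _ _ xpredT (iota (0 + a) _)); last first.
  by move=> i; rewrite mem_iota /=; lia.
rewrite (@eq_in_count _ _ xpred0 (iota (0 + a + _) _)); last first.
  by move=> i; rewrite mem_iota /=; lia.
by rewrite !count_pred0 count_predT size_iota; lia.
Qed.

Lemma in_uniform n r (A : {set 'I_n.+1}) :
  A \in uniform n r -> A \subset itv n 1 n /\ #|A| = r.
Proof. by rewrite inE => /andP[? /eqP]. Qed.

Lemma uniform_gt0 n r (A : {set 'I_n.+1}) i :
  A \in uniform n r -> i \in A -> 0 < i.
Proof. by case/in_uniform => /subsetP sA _ /sA; rewrite inE => /andP[]. Qed.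

Lemma eq_inord n k (i : 'I_n.+1) : k <= n -> (i == inord k) = (i == k :> nat).
Proof. by move=> kn; rewrite -val_eqE /= inordK. Qed.

Lemma cnt_le n (A : {set 'I_n.+1}) k l : k <= l -> cnt A k <= cnt A l.
Proof.
move=> kl; apply/subset_leq_card/subsetP => i; rewrite !inE => /andP[-> ik].
exact: leq_trans kl.
Qed.

Lemma cnt_leS n (A : {set 'I_n.+1}) k : cnt A k.+1 <= (cnt A k).+1.
Proof.
apply: (@leq_trans (#|[set inord k.+1 : 'I_n.+1]| + cnt A k)); last first.
  by rewrite cards1.
apply: leq_trans (leq_card_setU _ _); apply/subset_leq_card/subsetP => i.
rewrite !inE => /andP[-> ik]; have := ltn_ord i.
by case: (leqP i k) => [|ki ?]; rewrite ?orbT ?orbF // eq_inord; lia.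
Qed.

Lemma cnt_card n (A : {set 'I_n.+1}) k : cnt A k <= #|A|.
Proof. by apply/subset_leq_card/subsetP => i; rewrite inE => /andP[]. Qed.

Lemma cnt_sub n (A B : {set 'I_n.+1}) k :
  (forall i, i \in A -> i <= k -> i \in B) -> cnt A k <= cnt B k.
Proof.
move=> sAB; apply/subset_leq_card/subsetP => i; rewrite !inE => /andP[iA ik].
by rewrite ik (sAB i).
Qed.

Lemma cnt0 n r (A : {set 'I_n.+1}) : A \in uniform n r -> cnt A 0 = 0.
Proof.
move=> uA; apply: eq_card0 => i; rewrite !inE.
by apply/negP => /andP[/(uniform_gt0 uA)]; lia.
Qed.

Lemma cnt_gt0 n (A : {set 'I_n.+1}) k i : i \in A -> i <= k -> 0 < cnt A k.
Proof. by move=> iA ik; apply/card_gt0P; exists i; rewrite inE iA. Qed.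

Lemma cnt_ge2 n (A : {set 'I_n.+1}) k i j :
  i \in A -> j \in A -> i < j <= k -> 1 < cnt A k.
Proof.
move=> iA jA ijk; have <- : #|[set i; j]| = 2.
  by rewrite cards2 -val_eqE /=; lia.
apply/subset_leq_card/subsetP => l; rewrite !inE => /orP[]/eqP->.
  by rewrite iA; lia.
by rewrite jA; lia.
Qed.

Lemma cnt1 n r (A : {set 'I_n.+1}) :
  1 <= n -> A \in uniform n r -> (0 < cnt A 1) = (inord 1 \in A).
Proof.
move=> n1 uA; apply/idP/idP => [/card_gt0P[i]|A1]; last first.
  by apply: cnt_gt0 A1 _; rewrite inordK.
rewrite inE => /andP[iA i1].
suff <- : i = inord 1 by [].
by apply/eqP; rewrite eq_inord //; move: (uniform_gt0 uA iA); lia.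
Qed.

(** * Sets with prescribed and forbidden elements *)

Lemma subset_card_between (T : finType) (S V : {set T}) k :
  S \subset V -> #|S| <= k <= #|V| ->
  exists2 W : {set T}, S \subset W & W \subset V /\ #|W| = k.
Proof.
move=> sSV /andP[Sk kV].
have : 0 < #|[set A : {set T} | A \subset V :\: S & #|A| == k - #|S|]|.
  by rewrite cards_draws bin_gt0 cardsD (setIidPr sSV); lia.
case/card_gt0P => A; rewrite inE subsetD => /andP[/andP[sAV dAS] /eqP cA].
exists (S :|: A); first exact: subsetUl.
split; first by rewrite subUset sSV.
by rewrite cardsU setIC disjoint_setI0 // cards0 cA; lia.
Qed.

Definition between (n r : nat) (T Z : {set 'I_n.+1}) : {set {set 'I_n.+1}} :=
  [set A in uniform n r | (T \subset A) && [disjoint A & Z]].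

Lemma disjoint_setUl (T : finType) (A B C : {set T}) :
  [disjoint A :|: B & C] = [disjoint A & C] && [disjoint B & C].
Proof. by rewrite -!setI_eq0 setIUl setU_eq0. Qed.

(** Removing [T] is a bijection onto the subsets of size [r - #|T|] of the ground set without [T]
    and [Z]; adding [T] back is its inverse. *)
Lemma card_between n r (T Z : {set 'I_n.+1}) :
  T \subset itv n 1 n -> Z \subset itv n 1 n -> [disjoint T & Z] ->
  #|T| <= r -> #|between r T Z| = 'C(n - #|T| - #|Z|, r - #|T|).
Proof.
move=> sT sZ dTZ cT; set U := itv n 1 n :\: T :\: Z.
have cU : #|U| = n - #|T| - #|Z|.
  rewrite /U setDDl cardsD (setIidPr _) ?subUset ?sT // cardsU.
  by rewrite disjoint_setI0 // cards0 card_itv //; lia.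
rewrite -cU -cards_draws -[RHS](@card_in_imset _ _ (fun S => S :|: T)); last first.
  move=> A B; rewrite !inE !subsetD => /andP[/andP[/andP[_ dA] _] _].
  move=> /andP[/andP[/andP[_ dB] _] _] /(congr1 (fun S => S :\: T)).
  by rewrite !setDUl !setDv !setU0 !(setDidPl _).
apply: eq_card => A; apply/idP/imsetP.
  rewrite !inE => /andP[/andP[sA /eqP cA] /andP[sTA dAZ]].
  exists (A :\: T); last first.
    by rewrite setDE setUIl [~: T :|: T]setUC setUCr setIT; apply/esym/setUidPl.
  rewrite inE cardsD (setIidPr sTA) cA eqxx andbT.
  by rewrite subsetD setSD //= (disjointWl (subsetDl _ _) dAZ).
case=> S; rewrite inE !subsetD => /andP[/andP[/andP[sS dST] dSZ] /eqP cS] ->.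
rewrite !inE subUset sS sT subsetUr cardsU disjoint_setI0 // cards0 cS.
by rewrite disjoint_setUl dSZ dTZ subn0 subnK // eqxx.
Qed.

Lemma between_exists n r (T Z : {set 'I_n.+1}) :
  T \subset itv n 1 n -> Z \subset itv n 1 n -> [disjoint T & Z] ->
  #|T| <= r -> #|Z| + r <= n ->
  exists A, [/\ A \in uniform n r, T \subset A & [disjoint A & Z]].
Proof.
move=> sT sZ dTZ cT cZ; have : 0 < #|between r T Z|.
  by rewrite card_between // bin_gt0; lia.
by case/card_gt0P => A; rewrite inE => /and3P[]; exists A.
Qed.

(** * The star and the adjusted Hilton-Milner families are MLCIFs *)

Lemma left_compressed_cnt n r (F : {set {set 'I_n.+1}}) A B :
  F \subset uniform n r -> left_compressed r F -> A \in F ->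
  B \in uniform n r -> (forall k, cnt A k <= cnt B k) -> B \in F.
Proof.
move=> /subsetP sF lF FA uB dom; apply: lF (FA) (uB) _; apply: cnt_set_le => //.
by case/sF/in_uniform: FA => _ ->; case/in_uniform: uB => _ ->.
Qed.

Lemma inord_itv n k : 1 <= k <= n -> [set inord k] \subset itv n 1 n.
Proof. by move=> kn; rewrite sub1set inE inordK //; lia. Qed.

Lemma itvS n a b c d : c <= a -> b <= d -> itv n a b \subset itv n c d.
Proof. by move=> ca bd; apply/subsetP => i; rewrite !inE; lia. Qed.

Lemma in_star n r (A : {set 'I_n.+1}) :
  (A \in star n r) = (A \in uniform n r) && (inord 1 \in A).
Proof. by rewrite in_set. Qed.

Lemma star_LCIF n r : 1 <= n -> LCIF r (star n r).
Proof.
move=> n1; split.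
- by apply/subsetP => A; rewrite in_star => /andP[].
- move=> A B; rewrite !in_star => /andP[uA A1] uB /(set_le_cnt 1) dom.
  by rewrite uB -(cnt1 n1 uB); apply: leq_trans dom; rewrite (cnt1 n1 uA).
- move=> A B; rewrite !in_star => /andP[_ A1] /andP[_ B1].
  by apply/pred0Pn; exists (inord 1); rewrite /= A1.
Qed.

(** A set avoiding 1 cannot be added: since [2 * r <= n], some r-set through 1 is disjoint from
    it. *)
Lemma star_MLCIF n r : 1 <= r -> 2 * r <= n -> MLCIF r (star n r).
Proof.
move=> r1 rn; split=> [|G [sG _ iG] sSG]; first by apply: star_LCIF; lia.
apply/eqP; rewrite eqEsubset sSG andbT; apply/subsetP => A GA.
have uA := subsetP sG _ GA; have [sA cA] := in_uniform uA.
rewrite in_star uA /=; apply/negPn/negP => A1.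
have [||||B [uB sB dBA]] := @between_exists n r [set inord 1] A _ sA.
- by apply: inord_itv; lia.
- by rewrite disjoints1.
- by rewrite cards1.
- by rewrite cA; lia.
have SB : B \in star n r by rewrite in_star uB -sub1set.
by have := iG _ _ (subsetP sSG _ SB) GA; rewrite dBA.
Qed.

Lemma cnt_ge2_meets n r (A : {set 'I_n.+1}) t : 1 <= n ->
  A \in uniform n r -> 1 < cnt A t -> A :&: itv n 2 t != set0.
Proof.
move=> n1 uA c2; have : 0 < #|[set i in A | i <= t] :\ inord 1|.
  move: c2; rewrite /cnt (cardsD1 (inord 1)); case: (inord 1 \in _) => //.
  by rewrite add0n; apply: ltnW.
case/card_gt0P => i; rewrite !inE => /and3P[i1 iA it]; apply/set0Pn; exists i.
rewrite !inE iA it andbT.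
by move: i1 (uniform_gt0 uA iA); rewrite eq_inord //; lia.
Qed.

Lemma cnt_ge2_star n r (A : {set 'I_n.+1}) t : 1 <= n -> A \in uniform n r ->
  inord 1 \in A -> (1 < cnt A t) = (A :&: itv n 2 t != set0).
Proof.
move=> n1 uA A1; apply/idP/set0Pn => [/(cnt_ge2_meets n1 uA)/set0Pn //|[i]].
by rewrite !inE => /andP[iA it]; apply: cnt_ge2 A1 iA _; rewrite inordK.
Qed.

Lemma cnt_itv n r (A : {set 'I_n.+1}) t : 1 <= t <= n -> A \in uniform n r ->
  inord 1 \notin A -> (t.-1 <= cnt A t) = (itv n 2 t \subset A).
Proof.
move=> /andP[t1 tn] uA A1.
have s2 : [set i in A | i <= t] \subset itv n 2 t.
  apply/subsetP => i; rewrite !inE => /andP[iA ->]; rewrite andbT.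
  have i0 := uniform_gt0 uA iA; rewrite ltn_neqAle i0 andbT.
  by apply: contraNneq A1 => i1; rewrite i1 inord_val.
have c2 : #|itv n 2 t| = t.-1 by rewrite card_itv //; lia.
rewrite -c2 /cnt (geq_leqif (subset_leqif_card s2)).
apply/idP/idP => [/subset_trans->//|/subsetP sA].
  by apply/subsetP => i; rewrite inE => /andP[].
by apply/subsetP => i ii; rewrite inE sA //; move: ii; rewrite inE => /andP[].
Qed.

Lemma in_AHM n r t (A : {set 'I_n.+1}) :
  (A \in AHM n r t) =
  (A \in uniform n r) &&
    ((inord 1 \in A) && (A :&: itv n 2 t != set0) || (itv n 2 t \subset A)).
Proof. by rewrite in_setU !in_set -andbA -andb_orr. Qed.

Lemma in_AHM_cnt n r t (A : {set 'I_n.+1}) : 3 <= t <= n ->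
  (A \in AHM n r t) =
  (A \in uniform n r) &&
    (if inord 1 \in A then 1 < cnt A t else t.-1 <= cnt A t).
Proof.
move=> t3; rewrite in_AHM; case uA: (A \in uniform n r) => //=.
case: ifPn => A1 /=; last by rewrite (cnt_itv _ uA) //; lia.
rewrite (cnt_ge2_star _ _ uA) //; last by lia.
apply/orP/idP => [[//|sA]|]; last by left.
by apply/set0Pn; exists (inord 2); rewrite inE (subsetP sA) inE inordK; lia.
Qed.

Lemma AHM_LCIF n r t : 3 <= t <= n -> LCIF r (AHM n r t).
Proof.
move=> t3; have n1 : 1 <= n by lia.
split.
- by apply/subsetP => A; rewrite in_AHM => /andP[].
- move=> A B; rewrite !in_AHM_cnt // => /andP[uA hA] uB dom; rewrite uB /=.
  (* Only the counts at 1 and [t] matter. Compression can gain the element 1 but not lose it, and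
     when it is gained, [t.-1 >= 2] supplies the two elements required. *)
  have /(_ 1) := fun k => set_le_cnt k dom; have := set_le_cnt t dom.
  move: hA; rewrite -!(@cnt1 n r) //; do 2 (case: ifP => ?); lia.
- move=> A B; rewrite !in_AHM => /andP[_ hA] /andP[_ hB]; apply/pred0Pn.
  case/orP: hA hB => [/andP[A1 /set0Pn[i]]|/subsetP sA].
    rewrite inE => /andP[iA it] /orP[/andP[B1 _]|/subsetP sB].
      by exists (inord 1); rewrite /= A1.
    by exists i; rewrite /= iA sB.
  case/orP => [/andP[_ /set0Pn[i]]|/subsetP sB].
    by rewrite inE => /andP[iB it]; exists i; rewrite /= iB sA.
  by exists (inord 2); rewrite /= sA ?sB // inE inordK; lia.
Qed.

(** Let [A] belong to a larger intersecting family. If it contains 1 and misses [[2, t]], some r-set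
    containing [[2, t]] is disjoint from it; here [t <= r.+1] is what lets [[2, t]] fit. If it
    avoids both 1 and some [i] in [[2, t]], some r-set through 1 and [i] is disjoint from it. Both
    sets lie in [AHM n r t]. *)
Lemma AHM_MLCIF n r t : 3 <= t <= r.+1 -> 2 * r <= n -> MLCIF r (AHM n r t).
Proof.
move=> tr rn; split=> [|G [sG _ iG] sHG]; first by apply: AHM_LCIF; lia.
apply/eqP; rewrite eqEsubset sHG andbT; apply/subsetP => A GA.
have uA := subsetP sG _ GA; have [sA cA] := in_uniform uA.
have missed B : B \in AHM n r t -> ~~ [disjoint B & A].
  by move/(subsetP sHG) => GB; apply: iG.
rewrite in_AHM uA /=; case: (boolP (inord 1 \in A)) => /= A1.
  rewrite -[_ || _]negbK negb_or negbK; apply/negP => /andP[/eqP dA _].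
  have [||||B [uB sB dBA]] := @between_exists n r (itv n 2 t) A _ sA.
  - by apply: itvS; lia.
  - by rewrite -setI_eq0 setIC dA.
  - by rewrite card_itv; lia.
  - by rewrite cA; lia.
  by have := missed B; rewrite in_AHM uB sB orbT dBA => /(_ isT).
apply/subsetP => i it; apply/negPn/negP => iA.
have [||||B [uB sB dBA]] := @between_exists n r [set inord 1; i] A _ sA.
- rewrite subUset inord_itv ?sub1set ?inE; last by lia.
  by have := ltn_ord i; move: it; rewrite inE; lia.
- by rewrite disjoint_setUl !disjoints1 A1.
- by rewrite cards2; case: eqP => _; clear -tr; lia.
- by rewrite cA; lia.
have := missed B; rewrite in_AHM uB dBA => H.
have := H; case/(_ _)/negP => //=.
move: sB; rewrite subUset !sub1set => /andP[-> iB]; apply/orP; left.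
by apply/set0Pn; exists i; rewrite inE iB.
Qed.

(** * Reduction to the window [[1, 2r]] *)

(** If [A'] and [B'] were disjoint, their traces could be extended to complementary halves of the
    window. Each half is a compression of [A] or [B], so two disjoint sets would belong to [F]. *)
Lemma LCIF_window_intersecting n r (F : {set {set 'I_n.+1}}) A B A' B' :
  LCIF r F -> 2 * r <= n -> A \in F -> B \in F ->
  A' \in uniform n r -> B' \in uniform n r ->
  (forall k, k <= 2 * r -> cnt A k <= cnt A' k) ->
  (forall k, k <= 2 * r -> cnt B k <= cnt B' k) -> ~~ [disjoint A' & B'].
Proof.
move=> [sF lF iF] rn FA FB uA' uB' domA domB; apply/negP => dAB.
set W := itv n 1 (2 * r).
have cW : #|W| = 2 * r by rewrite card_itv //; lia.
have [sA' cA'] := in_uniform uA'; have [sB' cB'] := in_uniform uB'.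
have inW k i (C : {set 'I_n.+1}) :
    C \in uniform n r -> i \in C -> i <= k -> k <= 2 * r -> i \in W.
  by move=> uC iC ik kr; rewrite inE (uniform_gt0 uC iC) (leq_trans ik).
(* As [D] lies inside the window, its count beyond the window is already [r], so only the counts
   inside need comparing. *)
have dom_fill (C C' D : {set 'I_n.+1}) : C \in F -> C' \in uniform n r ->
    (forall k, k <= 2 * r -> cnt C k <= cnt C' k) ->
    C' :&: W \subset D -> D \subset W -> #|D| = r -> D \in F.
  move=> FC uC' dom sD DW cD; apply: (left_compressed_cnt sF lF FC).
    by rewrite inE cD eqxx andbT (subset_trans DW) // itvS.
  move=> k; have [kr|rk] := leqP k (2 * r).
    apply: leq_trans (dom k kr) _; apply: cnt_sub => i iC ik.
    by apply: (subsetP sD); rewrite inE iC (inW k _ C').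
  apply: leq_trans (cnt_card _ _) _.
  have [_ ->] := in_uniform (subsetP sF _ FC).
  rewrite -{1}cD; apply/subset_leq_card/subsetP => i iD; rewrite inE iD.
  move/(subsetP DW): iD; rewrite inE => /andP[_ ir].
  exact: leq_trans ir (ltnW rk).
have [||D sD [DV cD]] :=
    @subset_card_between _ (A' :&: W) (W :\: (B' :&: W)) r.
- rewrite subsetD subsetIr /=.
  exact: disjointWl (subsetIl _ _) (disjointWr (subsetIl _ _) dAB).
- rewrite -{1}cA' subset_leq_card ?subsetIl //=.
  rewrite cardsD (setIidPr (subsetIr _ _)) cW.
  have : #|B' :&: W| <= r by rewrite -cB' subset_leq_card // subsetIl.
  by clear; lia.
move: DV; rewrite subsetD => /andP[DW dDB].
have FD : D \in F by apply: (dom_fill A A').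
suff FD' : W :\: D \in F.
  by have := iF _ _ FD FD'; rewrite -setI_eq0 setIDA setIC setDIl setDv setI0 eqxx.
apply: (dom_fill B B') => //; last first.
  by rewrite cardsD (setIidPr DW) cW cD mul2n -addnn addnK.
  exact: subsetDl.
by rewrite subsetD subsetIr /= disjoint_sym.
Qed.

(** The r-sets whose window counts dominate those of some member form a left-compressed intersecting
    family [G] containing [F]; maximality gives [G = F]. *)
Lemma MLCIF_window n r (F : {set {set 'I_n.+1}}) A A' :
  MLCIF r F -> 2 * r <= n -> A \in F -> A' \in uniform n r ->
  (forall k, k <= 2 * r -> cnt A k <= cnt A' k) -> A' \in F.
Proof.
move=> [LF maxF] rn FA uA' dom; have [sF lF iF] := LF.
pose G := [set B in uniform n r |
  [exists A in F, [forall k : 'I_(2 * r).+1, cnt A k <= cnt B k]]].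
have GP B : B \in G -> B \in uniform n r /\
    exists2 A, A \in F & forall k, k <= 2 * r -> cnt A k <= cnt B k.
  rewrite in_set => /andP[uB /exists_inP[C FC /forallP domC]]; split=> //.
  by exists C => // k kr; have := domC (Ordinal (kr : k < (2 * r).+1)).
have inG B C : B \in uniform n r -> C \in F ->
    (forall k, k <= 2 * r -> cnt C k <= cnt B k) -> B \in G.
  move=> uB FC domB; rewrite in_set uB; apply/exists_inP; exists C => //.
  by apply/forallP => k; apply: domB; rewrite -ltnS.
suff LG : LCIF r G.
  rewrite -(maxF G LG); first exact: inG dom.
  by apply/subsetP => B FB; apply: (inG _ B) => //; apply: (subsetP sF).
split; first by apply/subsetP => B /GP[].
- move=> B C /GP[uB [D FD domD]] uC /set_le_cnt domB; apply: (inG _ D) => // k kr.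
  exact: leq_trans (domD k kr) (domB k).
- move=> B C /GP[uB [D FD domD]] /GP[uC [D' FD' domD']].
  exact: (LCIF_window_intersecting LF rn FD FD').
Qed.

(** * Structure of the families other than the star *)

(** By maximality [F] is not inside the star, so some member avoids 1, and [[2, r+1]] is the
    leftmost r-set avoiding 1. *)
Lemma nonstar_itv n r (F : {set {set 'I_n.+1}}) :
  MLCIF r F -> F <> star n r -> 1 <= r < n -> itv n 2 r.+1 \in F.
Proof.
move=> [[sF lF iF] maxF] nF rn.
have /subsetPn[A FA nSA] : ~~ (F \subset star n r).
  apply/negP => sFS; apply: nF; apply/esym/(maxF _ _ sFS).
  by apply: star_LCIF; lia.
have uA := subsetP sF _ FA; have [sA cA] := in_uniform uA.
have A1 : inord 1 \notin A by move: nSA; rewrite in_star uA.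
apply: (left_compressed_cnt sF lF FA).
  by rewrite inE itvS ?card_itv //=; try apply/eqP; lia.
move=> k; have [rk|kr] := leqP r.+1 k.
  apply: leq_trans (cnt_card _ _) _.
  apply: (@leq_trans #|itv n 2 r.+1|); first by rewrite cA card_itv; lia.
  apply/subset_leq_card/subsetP => i ii; rewrite inE ii.
  by move: ii; rewrite inE => /andP[_ /leq_trans->].
apply: (@leq_trans #|itv n 2 k|); apply/subset_leq_card/subsetP => i.
  rewrite !inE => /andP[iA ->]; rewrite andbT.
  rewrite ltn_neqAle (uniform_gt0 uA iA) andbT.
  by apply: contraNneq A1 => ->; rewrite inord_val.
by rewrite !inE => /andP[-> ik]; rewrite ik (leq_trans ik) // ltnW.
Qed.

(** From a member with at most one element in the window, [MLCIF_window] would produce a member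
    containing 1 and avoiding [[2, 2r]], hence disjoint from [[2, r+1]]. The bound [3 * r <= n]
    leaves room for its other elements. *)
Lemma nonstar_cnt_ge2 n r (F : {set {set 'I_n.+1}}) A :
  MLCIF r F -> F <> star n r -> 1 <= r -> 3 * r <= n -> A \in F ->
  1 < cnt A (2 * r).
Proof.
move=> MF nF r1 rn FA; have [[sF lF iF] _] := MF.
rewrite ltnNge; apply/negP => cA.
have uA := subsetP sF _ FA.
have [|||||B [uB]] :=
    @between_exists n r [set inord 1] (itv n 2 (2 * r)).
- by apply: inord_itv; lia.
- by apply: itvS; lia.
- by rewrite disjoints1 inE inordK //; lia.
- by rewrite cards1.
- by rewrite card_itv; lia.
rewrite sub1set => B1 dB.
have FB : B \in F.
  apply: (MLCIF_window MF _ FA uB); first by lia.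
  move=> [|k] kr; first by rewrite (cnt0 uA).
  apply: leq_trans (cnt_le A kr) _; apply: leq_trans cA _.
  by apply: cnt_gt0 B1 _; rewrite inordK //; lia.
have rn' : 1 <= r < n by lia.
have := iF _ _ FB (nonstar_itv MF nF rn'); rewrite (disjointWr _ dB) //.
by apply: itvS; lia.
Qed.

(** The window counts of [A] are at most 0, 1, 2 at the points 1, 2, 3 and never exceed 2. Every
    member of [AHM n r 3] has two elements in [[1, 3]], so it dominates [A] and lies in [F];
    maximality of [AHM n r 3] concludes. *)
Lemma nonstar_AHM3 n r (F : {set {set 'I_n.+1}}) A :
  MLCIF r F -> 3 <= r -> 3 * r <= n -> A \in F -> inord 1 \notin A ->
  cnt A (2 * r) <= 2 -> F = AHM n r 3.
Proof.
move=> MF r3 rn FA A1 cA; have [LF maxF] := MF; have [sF lF iF] := LF.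
have uA := subsetP sF _ FA.
have [_ max3] : MLCIF r (AHM n r 3) by apply: AHM_MLCIF; lia.
apply: max3 => //; apply/subsetP => B.
rewrite in_AHM_cnt; last by lia.
move=> /andP[uB hB].
have cB3 : 2 <= cnt B 3 by case: ifP hB.
apply: (MLCIF_window MF _ FA uB); first by lia.
have a1 : cnt A 1 = 0.
  by apply/eqP; rewrite -leqn0 leqNgt (cnt1 _ uA) //; lia.
move=> [|[|[|k]]] kr; rewrite ?a1 ?(cnt0 uA) //.
  have := cnt_leS A 1; have := cnt_leS B 2; rewrite a1; clear -cB3; lia.
exact: leq_trans (leq_trans (cnt_le A kr) cA) (leq_trans cB3 (cnt_le B _)).
Qed.

(* For [A] containing 1, [1 < cnt A j] says that [A] meets [[2, j]]. *)
Definition full_upto (n r : nat) (F : {set {set 'I_n.+1}}) (j : nat) : bool :=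
  [forall A in uniform n r, (inord 1 \in A) && (1 < cnt A j) ==> (A \in F)].

Lemma full_uptoP n r (F : {set {set 'I_n.+1}}) j :
  reflect (forall A, A \in uniform n r -> inord 1 \in A -> 1 < cnt A j ->
             A \in F) (full_upto r F j).
Proof.
apply: (iffP forall_inP) => [h A uA A1 cA|h A uA].
  by have := h A uA; rewrite A1 cA.
by apply/implyP => /andP[]; apply: h.
Qed.

(** Below [j] the set [A] has at most one element, and in the whole window at most two. A set
    through 1 with a second element at most [j] dominates these counts. *)
Lemma cnt2_full_upto n r (F : {set {set 'I_n.+1}}) A j :
  MLCIF r F -> 1 <= r -> 2 * r <= n -> A \in F ->
  j \in A -> j <= 2 * r -> cnt A (2 * r) <= 2 -> full_upto r F j.
Proof.
move=> MF r1 rn FA jA jr cA; have [[sF lF iF] _] := MF.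
have uA := subsetP sF _ FA.
apply/full_uptoP => B uB B1 cB; apply: (MLCIF_window MF rn FA uB) => k kr.
have [jk|kj] := leqP j k.
  exact: leq_trans (leq_trans (cnt_le A kr) cA) (leq_trans cB (cnt_le B jk)).
case: k kr kj => [|k] kr kj; first by rewrite (cnt0 uA).
apply: (@leq_trans 1); last first.
  by apply: cnt_gt0 B1 _; rewrite inordK //; clear -r1 rn; lia.
rewrite -ltnS; apply: leq_trans cA; apply: proper_card.
apply/properP; split.
  apply/subsetP => i; rewrite !inE => /andP[-> ik].
  exact: leq_trans ik kr.
by exists j; rewrite !inE jA // -ltnNge.
Qed.

(** If [B] missed some [i] in [[2, j]], an r-set through 1 and [i] disjoint from [B] would be a
    member by fullness. *)
Lemma full_upto_itv n r (F : {set {set 'I_n.+1}}) B j :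
  LCIF r F -> 2 <= r -> 2 * r <= n -> j <= n -> full_upto r F j ->
  B \in F -> inord 1 \notin B -> itv n 2 j \subset B.
Proof.
move=> [sF lF iF] r2 rn jn /full_uptoP fj FB B1.
have [sB cB] := in_uniform (subsetP sF _ FB).
apply/subsetP => i ij; apply/negPn/negP => iB.
have [i2 ij'] : 2 <= i /\ i <= j by move: ij; rewrite inE => /andP[].
have [||||A [uA sA dA]] := @between_exists n r [set inord 1; i] B _ sB.
- rewrite subUset inord_itv; last by clear -r2 rn; lia.
  by rewrite sub1set inE (ltnW i2) -ltnS ltn_ord.
- by rewrite disjoint_setUl !disjoints1 B1.
- by rewrite cards2; case: eqP => _; clear -r2; lia.
- by rewrite cB; clear -rn; lia.
move: sA; rewrite subUset !sub1set => /andP[A1 iA].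
suff FA : A \in F by have := iF _ _ FA FB; rewrite dA.
apply: fj => //; apply: cnt_ge2 A1 iA _.
by rewrite inordK ?i2 //; clear -r2 rn; lia.
Qed.

(** Apply [full_upto_itv] to the member [[2, r+1]], which avoids 1. *)
Lemma nonstar_full_upto_le n r (F : {set {set 'I_n.+1}}) j :
  MLCIF r F -> F <> star n r -> 2 <= r -> 2 * r <= n -> j <= n ->
  full_upto r F j -> j <= r.+1.
Proof.
move=> MF nF r2 rn jn fj; have rn' : 1 <= r < n by lia.
have FI := nonstar_itv MF nF rn'; have [LF _] := MF.
have nI : inord 1 \notin itv n 2 r.+1 by rewrite inE inordK; lia.
have := full_upto_itv LF r2 rn jn fj FI nI.
case: (leqP 2 j) => [j2|]; last by lia.
move=> /subsetP/(_ (inord j)); rewrite !inE inordK //.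
by rewrite j2 leqnn => /(_ isT).
Qed.

(** * Upper bound for the number of members hitting a set *)

Lemma leq_card_bigcup (T I : finType) (J : {set I}) (F : I -> {set T}) c :
  (forall i, i \in J -> #|F i| <= c) -> #|\bigcup_(i in J) F i| <= #|J| * c.
Proof.
move=> Fc; rewrite -sum_nat_const.
apply: (@leq_trans (\sum_(i in J) #|F i|)); last exact: leq_sum.
elim/big_rec2: _ => [|i m S _ IH]; first by rewrite cards0.
by rewrite (leq_trans (leq_card_setU _ _)) // leq_add2l.
Qed.

Lemma card_meet3 n r (W : {set 'I_n.+1}) : 3 <= r -> W \subset itv n 1 n ->
  #|[set A in uniform n r | 2 < #|A :&: W|]| <= 'C(#|W|, 3) * 'C(n - 3, r - 3).
Proof.
move=> r3 sW; rewrite -cards_draws.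
set P := [set T : {set 'I_n.+1} | _ & _].
apply: (@leq_trans #|\bigcup_(T in P) between r T set0|); last first.
  apply: leq_card_bigcup => T; rewrite inE => /andP[sT /eqP cT].
  rewrite card_between ?cT ?cards0 ?subn0 //.
  - exact: subset_trans sW.
  - exact: sub0set.
  - by rewrite -setI_eq0 setI0.
apply/subset_leq_card/subsetP => A; rewrite in_set => /andP[uA cA].
have [||T _ [sT cT]] := @subset_card_between _ set0 (A :&: W) 3.
- exact: sub0set.
- by rewrite cards0.
move: sT; rewrite subsetI => /andP[sTA sTW].
apply/bigcupP; exists T; first by rewrite inE sTW cT eqxx.
by rewrite in_set uA sTA -setI_eq0 setI0 eqxx.
Qed.

(** Members with three elements in [W] go into the error term. Any other member hitting [Y] has at
    most two elements in the window, hence contains 1 since [F] is not [AHM n r 3]; it is then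
    charged to a pair [{1, y}] with [y] in [Y] full. *)
Lemma hit_upper n r (F : {set {set 'I_n.+1}}) (Y : {set 'I_n.+1}) :
  MLCIF r F -> F <> star n r -> F <> AHM n r 3 -> 3 <= r -> 3 * r <= n ->
  Y \subset itv n 2 n ->
  hit Y F <= #|[set y in Y | full_upto r F y]| * 'C(n - 2, r - 2)
             + 'C(#|Y :|: itv n 1 (2 * r)|, 3) * 'C(n - 3, r - 3).
Proof.
move=> MF nS n3 r3 rn sY; have [[sF lF iF] _] := MF.
set W := Y :|: _; set J := [set y in Y | _].
have sW : W \subset itv n 1 n.
  by rewrite subUset (subset_trans sY) !itvS //; clear -rn; lia.
pose H (y : 'I_n.+1) := between r [set inord 1; y] set0.
pose K := [set A in uniform n r | 2 < #|A :&: W|].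
suff hK : hit Y F <= #|(\bigcup_(y in J) H y) :|: K|.
  apply: leq_trans hK (leq_trans (leq_card_setU _ _) _).
  apply: leq_add; last exact: card_meet3.
  apply: leq_card_bigcup => y; rewrite inE => /andP[/(subsetP sY)].
  rewrite inE => /andP[y2 _] _.
  have c2 : #|[set inord 1; y]| = 2.
    rewrite cards2 eq_sym eq_inord; last by clear -r3 rn; lia.
    by rewrite neq_ltn y2 orbT.
  rewrite card_between ?c2 ?cards0 ?subn0 ?(ltnW r3) //.
  - rewrite subUset inord_itv; last by clear -r3 rn; lia.
    by rewrite sub1set inE (ltnW y2) -ltnS ltn_ord.
  - exact: sub0set.
  - by rewrite -setI_eq0 setI0.
apply/subset_leq_card/subsetP => A.
rewrite in_set => /andP[FA /set0Pn[y]]; rewrite inE => /andP[yA yY].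
have uA := subsetP sF _ FA; rewrite inE in_set uA /=.
have [cW|cW] := ltnP 2 #|A :&: W|; rewrite ?orbT // orbF.
have r1 : 1 <= r by apply: ltnW (ltnW r3).
have rn2 : 2 * r <= n by clear -rn; lia.
have sAW : [set i in A | i <= 2 * r] \subset A :&: W.
  apply/subsetP => i; rewrite inE => /andP[iA ir].
  by rewrite !inE iA ir (uniform_gt0 uA iA) orbT.
have cA : cnt A (2 * r) <= 2 by apply: leq_trans cW; apply: subset_leq_card.
have A1 : inord 1 \in A.
  by apply/negPn/negP => A1; apply: n3; apply: nonstar_AHM3 A1 cA.
have [yr|ry] := leqP y (2 * r).
  apply/bigcupP; exists y; first by rewrite inE yY (cnt2_full_upto MF _ _ FA).
  by rewrite in_set uA subUset !sub1set A1 yA -setI_eq0 setI0 eqxx.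
(* A hit [y] beyond the window would leave at most one of the two elements of [A :&: W] inside the
   window. *)
have := nonstar_cnt_ge2 MF nS r1 rn FA; rewrite ltnNge => /negP[].
rewrite -ltnS; apply: leq_trans cW; apply: proper_card; apply/properP; split=> //.
by exists y; rewrite !inE ?yA ?yY //= -ltnNge.
Qed.

(** * Binomial estimates and exact hit counts *)

Lemma in_between n r (T Z A : {set 'I_n.+1}) : (A \in between r T Z) =
  [&& A \in uniform n r, T \subset A & [disjoint A & Z]].
Proof. by rewrite in_set. Qed.

Lemma in_hitting n (F : {set {set 'I_n.+1}}) (X A : {set 'I_n.+1}) :
  (A \in [set B in F | B :&: X != set0]) = (A \in F) && (A :&: X != set0).
Proof. by rewrite in_set. Qed.

(** The identity (n-2) C(n-3, r-3) = (r-2) C(n-2, r-2) gives the ratio (n-2)/(r-2), which exceeds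
    [c] under the bound on [n]. *)
Lemma bin_dominates c n r : 3 <= r -> c * r + r <= n ->
  c * 'C(n - 3, r - 3) < 'C(n - 2, r - 2).
Proof.
move=> r3 cn; have := mul_bin_diag (n - 2) (r - 3).
have -> : (n - 2).-1 = n - 3 by lia.
have -> : (r - 3).+1 = r - 2 by lia.
have : 0 < 'C(n - 3, r - 3) by rewrite bin_gt0; lia.
by move: 'C(_, _) 'C(_, _) => E D E0 eD; nia.
Qed.

(** Pascal's rule is applied [i] times, each step losing at most C(n-3, r-3). *)
Lemma bin_drop n r i : 3 <= r -> 'C(n - 2, r - 2) <=
  'C(n - 2 - i, r - 2) + i * 'C(n - 3, r - 3).
Proof.
move=> r3; elim: i => [|i IHi]; first by rewrite subn0; lia.
apply: leq_trans IHi _.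
case E: (n - 2 - i) => [|m]; first by rewrite (_ : n - 2 - i.+1 = 0); lia.
have -> : n - 2 - i.+1 = m by lia.
have {1}-> : r - 2 = (r - 3).+1 by lia.
rewrite binS (_ : (r - 3).+1 = r - 2); last by lia.
have : 'C(m, r - 3) <= 'C(n - 3, r - 3) by apply: leq_bin2l; lia.
by lia.
Qed.

Lemma bin_bonferroni n r k : 3 <= r -> k < n ->
  k * 'C(n - 2, r - 2) + 'C(n - 1 - k, r - 1) <=
  'C(n - 1, r - 1) + k * k * 'C(n - 3, r - 3).
Proof.
move=> r3; elim: k => [|k IHk] kn; first by rewrite subn0; lia.
have {}IHk := IHk (ltnW kn).
have := bin_drop n k r3.
have := binS (n - 2 - k) (r - 2).
have -> : (n - 2 - k).+1 = n - 1 - k by lia.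
have -> : (r - 2).+1 = r - 1 by lia.
have -> : n - 1 - k.+1 = n - 2 - k by lia.
by nia.
Qed.

Lemma card_between1 n r (Z : {set 'I_n.+1}) : 1 <= r -> 1 <= n ->
  Z \subset itv n 2 n -> #|between r [set inord 1] Z| = 'C(n - 1 - #|Z|, r - 1).
Proof.
move=> r1 n1 sZ; rewrite card_between ?cards1 //.
- exact: inord_itv.
- by apply: subset_trans sZ _; apply: itvS.
- by rewrite disjoints1; apply/negP => /(subsetP sZ); rewrite inE inordK.
Qed.

Lemma hit_star n r (X : {set 'I_n.+1}) : 1 <= r -> 1 <= n ->
  X \subset itv n 2 n ->
  hit X (star n r) + 'C(n - 1 - #|X|, r - 1) = 'C(n - 1, r - 1).
Proof.
move=> r1 n1 sX; rewrite -card_between1 //.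
have <- : #|star n r| = 'C(n - 1, r - 1).
  have := @card_between1 n r set0 r1 n1 (sub0set _); rewrite cards0 subn0 => <-.
  apply: eq_card => A; rewrite in_star in_between sub1set.
  by rewrite -setI_eq0 setI0 eqxx andbT.
pose P := [set A : {set 'I_n.+1} | A :&: X != set0].
have inP A : (A \in P) = (A :&: X != set0) by rewrite inE.
rewrite -(cardsID P (star n r)); congr (_ + _); apply: eq_card => A.
  by rewrite in_hitting in_setI inP.
by rewrite in_between in_setD in_star inP sub1set negbK setI_eq0 andbA andbC.
Qed.

(** The parameter [k] may stay below [#|X|], so that for large [X] the error term remains bounded in
    terms of [r]. *)
Lemma hit_star_lower n r k (X : {set 'I_n.+1}) : 3 <= r -> 1 <= n -> k < n ->
  X \subset itv n 2 n -> k <= #|X| ->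
  k * 'C(n - 2, r - 2) <= hit X (star n r) + k * k * 'C(n - 3, r - 3).
Proof.
move=> r3 n1 kn sX kX; have := bin_bonferroni r3 kn.
rewrite -(@hit_star n r X) //; last by lia.
have : 'C(n - 1 - #|X|, r - 1) <= 'C(n - 1 - k, r - 1) by apply: leq_bin2l; lia.
by lia.
Qed.

(** Passing from the star to [AHM n r t] exchanges the sets through 1 that miss [[2, t]] for the
    sets that contain [[2, t]] and avoid 1. The balance is stated additively to avoid truncated
    subtraction. *)
Lemma hit_AHM n r t (X : {set 'I_n.+1}) : 2 <= t <= n ->
  hit X (AHM n r t) +
    #|[set A in between r [set inord 1] (itv n 2 t) | A :&: X != set0]| =
  hit X (star n r) +
    #|[set A in between r (itv n 2 t) [set inord 1] | A :&: X != set0]|.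
Proof.
move=> t2.
pose P := [set A : {set 'I_n.+1} | inord 1 \in A].
pose Q := [set A : {set 'I_n.+1} | A :&: itv n 2 t != set0].
have inP A : (A \in P) = (inord 1 \in A) by rewrite inE.
have inQ A : (A \in Q) = (A :&: itv n 2 t != set0) by rewrite inE.
have i2 : inord 2 \in itv n 2 t by rewrite inE inordK; lia.
rewrite /hit -(cardsID P [set A in AHM n r t | _]).
rewrite -(cardsID Q [set A in star n r | _]) addnAC; congr (_ + _ + _).
- apply: eq_card => A; rewrite !in_setI !in_hitting inP inQ in_AHM in_star -!andbA.
  case: (A \in uniform n r) => //=; case: (inord 1 \in A); rewrite ?andbF //=.
  rewrite !andbT andbC; congr (_ && _).
  apply/orP/idP => [[//|/subsetP s]|]; last by left.
  by apply/set0Pn; exists (inord 2); rewrite in_setI s.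
- apply: eq_card => A; rewrite in_setD !in_hitting in_between in_star inQ.
  rewrite sub1set negbK [_ :&: itv n 2 t == _]setI_eq0.
  move: (A \in uniform n r) (inord 1 \in A) (A :&: X != set0).
  by move: [disjoint A & itv n 2 t]; do 4 case.
- apply: eq_card => A; rewrite in_setD !in_hitting in_between in_AHM inP.
  rewrite [in RHS]disjoint_sym disjoints1.
  case: (A \in uniform n r) => //=; rewrite ?andbF //=.
  by case: (inord 1 \in A); rewrite ?andbF //= andbT.
Qed.

Lemma card_between_itv n r t : 2 <= t <= r.+1 -> r < n ->
  #|between r (itv n 2 t) [set inord 1]| = 'C(n - t, r.+1 - t).
Proof.
move=> tr rn; rewrite card_between ?cards1 ?card_itv; try lia.
- by congr 'C(_, _); lia.
- by apply: itvS; lia.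
- by apply: inord_itv; lia.
- by rewrite disjoint_sym disjoints1 inE inordK; lia.
Qed.

(** None of the sets lost in the exchange hits [X], and all of the sets gained do. *)
Lemma hit_AHM_max n r t (X : {set 'I_n.+1}) :
  2 <= t <= r.+1 -> r < n -> X != set0 -> X \subset itv n 2 t ->
  hit X (AHM n r t) = hit X (star n r) + 'C(n - t, r.+1 - t).
Proof.
move=> tr rn /set0Pn[x xX] sX; have t2 : 2 <= t <= n by lia.
have := @hit_AHM n r t X t2; rewrite -card_between_itv //.
rewrite [X in _ + X = _](_ : _ = 0) ?addn0 => [->|].
  congr (_ + _); apply: eq_card => A; rewrite in_hitting !in_between.
  case: (boolP (itv n 2 t \subset A)) => sA; rewrite ?andbF //= andbC.
  suff -> : A :&: X != set0 by [].
  by apply/set0Pn; exists x; rewrite inE xX (subsetP sA) // (subsetP sX).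
apply: eq_card0 => A; rewrite in_hitting in_between.
apply/negP => /andP[/and3P[_ _ dA]] /set0Pn[y].
by rewrite inE => /andP[yA /(subsetP sX)]; rewrite (disjointFr dA).
Qed.

Lemma card_between_1y n r (y : 'I_n.+1) (Z : {set 'I_n.+1}) :
  2 <= r -> 1 <= n -> 2 <= y -> y \notin Z -> Z \subset itv n 2 n ->
  #|between r [set inord 1; y] Z| = 'C(n - 2 - #|Z|, r - 2).
Proof.
move=> r2 n1 y2 yZ sZ.
have c2 : #|[set inord 1; y]| = 2.
  by rewrite cards2 eq_sym eq_inord // neq_ltn y2 orbT.
rewrite card_between ?c2 //.
- by rewrite subUset inord_itv // sub1set inE (ltnW y2) -ltnS ltn_ord.
- by apply: subset_trans sZ _; apply: itvS.
- rewrite disjoint_setUl !disjoints1 yZ andbT.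
  by apply/negP => /(subsetP sZ); rewrite inE inordK.
Qed.

(** The exchange gains C(n-3, r-2) hitting sets and loses the C(n-4, r-2) sets through 1 and [y]
    that avoid 2 and 3. By Pascal the net gain is the one [hit_AHM_max] gives for [t = 4], whence
    the ties between [AHM n r 3] and [AHM n r 4]. *)
Lemma hit_AHM3_one n r y (X : {set 'I_n.+1}) : 3 <= r < n ->
  X \subset itv n 2 n -> X :&: itv n 2 3 != set0 -> X :\: itv n 2 3 = [set y] ->
  hit X (AHM n r 3) = hit X (star n r) + 'C(n - 4, r.+1 - 4).
Proof.
move=> r3 sX /set0Pn[x]; rewrite inE => /andP[xX x23] eX.
have : y \in X :\: itv n 2 3 by rewrite eX set11.
rewrite in_setD => /andP[y23 yX].
have y2 : 2 <= y by move/(subsetP sX): yX; rewrite inE => /andP[].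
have t3 : 2 <= 3 <= n by lia.
have := @hit_AHM n r 3 X t3.
rewrite [X in _ = _ + X](_ : _ = 'C(n - 3, r - 2)); last first.
  transitivity #|between r (itv n 2 3) [set inord 1]|; last first.
    by rewrite card_between_itv; try lia; congr 'C(_, _); lia.
  apply: eq_card => A; rewrite in_hitting !in_between.
  case: (boolP (itv n 2 3 \subset A)) => sA; rewrite ?andbF //= andbC.
  suff -> : A :&: X != set0 by [].
  by apply/set0Pn; exists x; rewrite inE xX (subsetP sA).
rewrite [X in _ + X = _](_ : _ = 'C(n - 4, r - 2)); last first.
  transitivity #|between r [set inord 1; y] (itv n 2 3)|; last first.
    rewrite card_between_1y ?itvS // ?card_itv; try lia.
    by congr 'C(_, _); lia.
  apply: eq_card => A; rewrite in_hitting !in_between subUset !sub1set -!andbA.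
  congr (_ && (_ && _)); rewrite andbC.
  case: (boolP [disjoint A & itv n 2 3]) => dA; rewrite ?andbF // !andbT.
  apply/set0Pn/idP => [[z]|yA]; last by exists y; rewrite inE yA.
  rewrite inE => /andP[zA zX].
  have : z \in X :\: itv n 2 3 by rewrite inE zX (disjointFr dA zA).
  by rewrite eX inE => /eqP <-.
have := binS (n - 4) (r - 3).
rewrite (_ : (n - 4).+1 = n - 3); last by lia.
rewrite (_ : (r - 3).+1 = r - 2); last by lia.
rewrite (_ : r.+1 - 4 = r - 3); last by lia.
by lia.
Qed.

(** The exchange gains only C(n-4, r-3) sets through [y] and loses C(n-4, r-2) of them, a larger
    order of magnitude. *)
Lemma hit_AHM3_single n r (y : 'I_n.+1) :
  3 <= r -> 4 * r + r <= n -> 4 <= y ->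
  hit [set y] (AHM n r 3) < hit [set y] (star n r).
Proof.
move=> r3 rn y4; have t3 : 2 <= 3 <= n by lia.
have y23 : y \notin itv n 2 3 by rewrite inE; lia.
have := @hit_AHM n r 3 [set y] t3.
have hy (A : {set 'I_n.+1}) : (A :&: [set y] != set0) = (y \in A).
  by rewrite setI_eq0 disjoint_sym disjoints1 negbK.
rewrite [X in _ = _ + X](_ : _ = 'C(n - 4, r - 3)); last first.
  transitivity #|between r (y |: itv n 2 3) [set inord 1]|.
    apply: eq_card => A; rewrite in_hitting !in_between hy subUset sub1set.
    by rewrite [_ && (y \in A)]andbC andbCA -!andbA.
  have c3 : #|y |: itv n 2 3| = 3 by rewrite cardsU1 y23 card_itv; lia.
  rewrite card_between ?c3 ?cards1 //.
  - by congr 'C(_, _); lia.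
  - by rewrite subUset itvS ?sub1set ?inE; have := ltn_ord y; lia.
  - by apply: inord_itv; lia.
  - rewrite disjoint_sym disjoints1 !inE inordK; last by lia.
    by rewrite eq_sym eq_inord; lia.
rewrite [X in _ + X = _](_ : _ = 'C(n - 4, r - 2)); last first.
  transitivity #|between r [set inord 1; y] (itv n 2 3)|; last first.
    rewrite card_between_1y ?itvS // ?card_itv; try lia.
    by congr 'C(_, _); lia.
  apply: eq_card => A; rewrite in_hitting !in_between hy subUset !sub1set.
  by rewrite -!andbA; congr (_ && (_ && _)); rewrite andbC.
have := bin_dominates r3 rn; have := bin_drop n 2 r3.
rewrite (_ : n - 2 - 2 = n - 4); last by lia.
have : 'C(n - 4, r - 3) <= 'C(n - 3, r - 3) by apply: leq_bin2l; lia.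
by lia.
Qed.

(** At most C(n-3, r-2) sets are gained, while two points of [X] beyond 3 cost at least C(n-4, r-2)
    + C(n-5, r-2), nearly twice as many. *)
Lemma hit_AHM3_two n r (X : {set 'I_n.+1}) :
  3 <= r -> 4 * r + r <= n -> X \subset itv n 2 n ->
  1 < #|X :\: itv n 2 3| -> hit X (AHM n r 3) < hit X (star n r).
Proof.
move=> r3 rn sX /card_gt1P[y [z [yX zX yz]]].
have t3 : 2 <= 3 <= n by lia.
have := @hit_AHM n r 3 X t3.
move: yX zX; rewrite !in_setD => /andP[y23 yX] /andP[z23 zX].
have ge2 x : x \in X -> 2 <= x by move/(subsetP sX); rewrite inE => /andP[].
set M := [set A in between r [set inord 1] _ | _].
set Q := [set A in between r (itv n 2 3) _ | _].
have cQ : #|Q| <= 'C(n - 3, r - 2).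
  apply: (@leq_trans #|between r (itv n 2 3) [set inord 1]|).
    by apply/subset_leq_card/subsetP => A; rewrite in_hitting => /andP[].
  rewrite card_between_itv; try lia.
  by apply: eq_leq; congr 'C(_, _); lia.
have s23 : itv n 2 3 \subset itv n 2 n by apply: itvS; clear -t3; lia.
have cM : 'C(n - 4, r - 2) + 'C(n - 5, r - 2) <= #|M|.
  (* Forbidding [y] in the second family makes the two families disjoint, so their sizes add up. *)
  pose B1 := between r [set inord 1; y] (itv n 2 3).
  pose B2 := between r [set inord 1; z] (y |: itv n 2 3).
  have c1 : #|B1| = 'C(n - 4, r - 2).
    rewrite card_between_1y ?ge2 // ?card_itv; try (clear -r3 rn; lia).
    by congr 'C(_, _); clear -r3 rn; lia.
  have c2 : #|B2| = 'C(n - 5, r - 2).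
    rewrite card_between_1y ?ge2 //; try (clear -r3 rn; lia).
    - rewrite cardsU1 y23 card_itv; last by clear -t3; lia.
      by congr 'C(_, _); clear -r3 rn; lia.
    - by rewrite in_setU1 negb_or eq_sym yz.
    - by rewrite subUset sub1set (subsetP sX).
  have dB : [disjoint B1 & B2].
    apply/pred0P => A /=; apply/negP; rewrite !in_between.
    rewrite subUset !sub1set => /andP[/and3P[_ /andP[_ yA] _]].
    move=> /and3P[_ _]; rewrite disjoint_sym disjoint_setUl disjoints1 yA.
    by [].
  have <- : #|B1 :|: B2| = 'C(n - 4, r - 2) + 'C(n - 5, r - 2).
    by rewrite -c1 -c2; apply/eqP; rewrite (leq_card_setU B1 B2).2.
  apply/subset_leq_card/subsetP => A; rewrite in_setU in_hitting.
  rewrite !in_between !subUset !sub1set.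
  case/orP => /and3P[-> /andP[-> xA] dA] /=.
    by rewrite dA; apply/set0Pn; exists y; rewrite inE xA.
  move: dA; rewrite disjoint_sym disjoint_setUl => /andP[_].
  by rewrite disjoint_sym => -> /=; apply/set0Pn; exists z; rewrite inE xA.
have := bin_dominates r3 rn; have := bin_drop n 3 r3.
rewrite (_ : n - 2 - 3 = n - 5); last by clear; lia.
have := binS (n - 4) (r - 3).
rewrite (_ : (n - 4).+1 = n - 3); last by clear -r3 rn; lia.
rewrite (_ : (r - 3).+1 = r - 2); last by clear -r3; lia.
have : 'C(n - 4, r - 3) <= 'C(n - 3, r - 3) by apply: leq_bin2l; clear; lia.
clear -cQ cM; lia.
Qed.

(** * Comparison with the star for large [n] *)

(** The shape [c * r + r] is the one [bin_dominates] asks for. The summands of [c] bound the triples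
    in the window enlarged by at most [2 * r] points, the squared error factor in the lower bound
    for the star, and a slack of 10 that yields [11 * r <= n]. *)
Definition threshold (r : nat) : nat :=
  ('C(4 * r, 3) + (2 * r).+1 * (2 * r).+1 + 10) * r + r.

Lemma threshold_ge r n : threshold r <= n -> 11 * r <= n.
Proof. rewrite /threshold; nia. Qed.

Lemma max_mem n (X : {set 'I_n.+1}) : X != set0 ->
  exists2 x, x \in X & \max_(i in X) i = x :> nat.
Proof.
rewrite -card_gt0 => /(eq_bigmax_cond (fun i : 'I_n.+1 => i : nat))[x xX ->].
by exists x.
Qed.

Lemma sub_itv_max n (X : {set 'I_n.+1}) : X \subset itv n 2 n ->
  X \subset itv n 2 (\max_(i in X) i).
Proof.
move=> /subsetP sX; apply/subsetP => x xX; have := sX x xX.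
by rewrite !inE => /andP[-> _]; apply: leq_bigmax_cond.
Qed.

Lemma card_window n r (Y : {set 'I_n.+1}) : 2 * r <= n -> #|Y| <= 2 * r ->
  'C(#|Y :|: itv n 1 (2 * r)|, 3) <= 'C(4 * r, 3).
Proof.
move=> rn cY; apply: leq_bin2l; apply: leq_trans (leq_card_setU _ _) _.
by rewrite card_itv; lia.
Qed.

(** Having fewer pairs costs at least one [D], which outweighs the two error terms, together at most
    [(c + s) * E]. *)
Lemma leading_term_wins c s D E j k q h :
  (c + s + 10) * E < D -> j < k -> q <= c -> k * k <= s ->
  k * D <= h + k * k * E -> j * D + q * E < h.
Proof.
move=> dom jk qc ks low.
have := leq_mul jk (leqnn D); have := leq_mul qc (leqnn E).
have := leq_mul ks (leqnn E).
by move: (k * k * E) (k * D) (q * E) low dom => *; nia.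
Qed.

(** If [X] has at most [2 * r] points and one of them is not full, [F] has fewer leading terms than
    the star and loses; otherwise the maximum of [X] is full. *)
Lemma nonstar_dichotomy n r (F : {set {set 'I_n.+1}}) (X : {set 'I_n.+1}) :
  3 <= r -> threshold r <= n -> X != set0 -> X \subset itv n 2 n ->
  MLCIF r F -> F <> star n r -> F <> AHM n r 3 ->
  hit X F < hit X (star n r) \/ full_upto r F (\max_(i in X) i).
Proof.
move=> r3 rn X0 sX MF nS n3; have n11 := threshold_ge rn.
have [n1 rn2 rn3] : [/\ 1 <= n, 2 * r <= n & 3 * r <= n] by split; lia.
have dom := bin_dominates r3 rn.
have up Y := @hit_upper n r F Y MF nS n3 r3 rn3.
have low k := @hit_star_lower n r k X r3 n1.
have [rX|Xr] := ltnP (2 * r) #|X|.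
  (* For large [X] the triples in the enlarged window are not bounded by [r]. Every member meets [Y
     = [2, 2r]], so [Y] replaces [X] for the upper bound, against [(2 * r).+1] points of [X] for the
     star. *)
  left; set Y := itv n 2 (2 * r).
  have cY : #|Y| <= 2 * r by rewrite card_itv //; clear; lia.
  have sY : Y \subset itv n 2 n by apply: itvS.
  have hXY : hit X F <= hit Y F.
    apply/subset_leq_card/subsetP => A; rewrite !in_hitting => /andP[FA _].
    rewrite FA /=; have [[sF _ _] _] := MF.
    apply: (cnt_ge2_meets n1 (subsetP sF _ FA)).
    by apply: (nonstar_cnt_ge2 MF) => //; clear -r3; lia.
  apply: leq_ltn_trans hXY _; apply: leq_ltn_trans (up Y sY) _.
  have kn : (2 * r).+1 < n by clear -n11 r3; lia.
  apply: leading_term_wins dom _ (card_window rn2 cY) _ (low _ kn sX rX) => //.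
  rewrite ltnS; apply: leq_trans cY; apply/subset_leq_card/subsetP => y.
  by rewrite inE => /andP[].
have [/forall_inP fX|] := boolP [forall x in X, full_upto r F x].
  by right; have [x xX ->] := max_mem X0; apply: fX.
rewrite negb_forall_in => /exists_inP[x xX nx]; left.
apply: leq_ltn_trans (up X sX) _.
have kn : #|X| < n by clear -Xr n11 r3; lia.
apply: leading_term_wins dom _ (card_window rn2 Xr) _ (low _ kn sX (leqnn _)).
  apply: proper_card; apply/properP; split.
    by apply/subsetP => y; rewrite inE => /andP[].
  by exists x => //; rewrite inE xX.
by apply: leq_mul; apply: leqW.
Qed.

(** Members avoiding 1 contain [[2, m]], and members through 1 that hit [X] meet [[2, m]]; so all
    members hitting [X] lie in [AHM n r m]. *)
Lemma full_hit n r m (F : {set {set 'I_n.+1}}) (X : {set 'I_n.+1}) :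
  3 <= r -> 2 * r <= n -> 3 <= m <= r.+1 -> X != set0 -> X \subset itv n 2 m ->
  MLCIF r F -> full_upto r F m -> F = AHM n r m \/ hit X F < hit X (AHM n r m).
Proof.
move=> r3 rn mr /set0Pn[x xX] sX MF fm; have [LF maxF] := MF.
have [sF lF iF] := LF.
have mn : 3 <= m <= n by clear -mr rn r3; lia.
have n1 : 1 <= n by clear -mn; lia.
have [_ maxH] : MLCIF r (AHM n r m) by apply: AHM_MLCIF.
have sub : [set A in F | A :&: X != set0] \subset
           [set A in AHM n r m | A :&: X != set0].
  apply/subsetP => A; rewrite !in_hitting => /andP[FA hA]; rewrite hA andbT.
  have uA := subsetP sF _ FA; rewrite in_AHM uA /=.
  have [A1|A1] := boolP (inord 1 \in A) => /=; last first.
    by apply: full_upto_itv LF _ rn _ fm FA A1; clear -r3 mn; lia.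
  apply/orP; left; move: hA => /set0Pn[y]; rewrite inE => /andP[yA yX].
  by apply/set0Pn; exists y; rewrite inE yA (subsetP sX).
have := subset_leq_card sub; rewrite leq_eqVlt => /orP[/eqP eH|]; last by right.
(* With equal counts the hitting members coincide. Sets containing [[2, m]] hit [X], hence lie in
   [F]; the rest of [AHM n r m] lies in [F] by fullness. *)
left; apply: maxH => //; apply/subsetP => A HA.
move/eqP: (eH); rewrite (subset_leqif_cards sub).2 => /eqP eS.
have := HA; rewrite in_AHM => /andP[uA /orP[/andP[A1 mA]|sA]].
  by move/full_uptoP: fm; apply=> //; rewrite (cnt_ge2_star _ n1 uA).
have : A \in [set A in AHM n r m | A :&: X != set0].
  rewrite in_hitting HA; apply/set0Pn; exists x.
  by rewrite inE xX (subsetP sA) // (subsetP sX).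
by rewrite -eS in_hitting => /andP[].
Qed.

Lemma bin_diag_step n r t : t <= r -> r.+1 < n ->
  'C(n - t.+1, r.+1 - t.+1) < 'C(n - t, r.+1 - t).
Proof.
move=> tr rn; have -> : n - t = (n - t.+1).+1 by lia.
have -> : r.+1 - t = (r.+1 - t.+1).+1 by lia.
by rewrite binS -{1}[X in X < _]add0n ltn_add2r bin_gt0; lia.
Qed.

(** These binomials are the gains over the star in [hit_AHM_max]: the gain shrinks strictly as [t]
    grows. *)
Lemma bin_diag_lt n r s t : s < t <= r.+1 -> r.+1 < n ->
  'C(n - t, r.+1 - t) < 'C(n - s, r.+1 - s).
Proof.
move=> /andP[]; elim: t => // t IHt; rewrite ltnS leq_eqVlt => /orP[/eqP->|st] tr rn.
  by apply: bin_diag_step; lia.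
by apply: ltn_trans (IHt st _ rn); [apply: bin_diag_step; lia | lia].
Qed.

(** * Optimal families for each kind of [X] *)

(** Common pattern of the cases below: [P] collects the claimed optima, tied at [h], and all other
    MLCIFs fall strictly below; [O] witnesses that [h] is attained. *)
Lemma optimal_iff n r (X : {set 'I_n.+1}) (P : {set {set 'I_n.+1}} -> Prop) O h :
  P O -> (forall F, P F -> MLCIF r F /\ hit X F = h) ->
  (forall F, MLCIF r F -> P F \/ hit X F < h) ->
  forall F, optimal r X F <-> P F.
Proof.
move=> PO Ph Pall F; split=> [[MF optF]|PF].
  case: (Pall F MF) => // ltF; have [MO hO] := Ph O PO.
  by have := optF O MO; rewrite hO leqNgt ltF.
have [MF hF] := Ph F PF; split=> // G MG; rewrite hF.
by case: (Pall G MG) => [/Ph[_ ->]|/ltnW].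
Qed.

(** Here the maximum is 2, too small for [full_hit], so [hit_upper] is used directly: a competitor
    reaches about one leading term, while [AHM n r 3] reaches about two. *)
Lemma optimal_2 n r : 3 <= r -> threshold r <= n ->
  forall F, optimal r [set inord 2 : 'I_n.+1] F <-> F = AHM n r 3.
Proof.
move=> r3 rn; have n11 := threshold_ge rn.
have [n1 rn2 rn3] : [/\ 1 <= n, 2 * r <= n & 3 * r <= n] by split; lia.
set X := [set inord 2 : 'I_n.+1].
have sX : X \subset itv n 2 n by rewrite sub1set inE inordK; lia.
have X0 : X != set0 by apply/set0Pn; exists (inord 2); rewrite set11.
have M3 : MLCIF r (AHM n r 3) by apply: AHM_MLCIF; lia.
have h3 : hit X (AHM n r 3) = hit X (star n r) + 'C(n - 3, r.+1 - 3).
  by apply: hit_AHM_max => //; try lia; rewrite sub1set inE inordK; lia.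
have e3 : 0 < 'C(n - 3, r.+1 - 3) by rewrite bin_gt0; lia.
apply: (@optimal_iff _ _ X _ (AHM n r 3) (hit X (AHM n r 3))) => // [F ->//|F MF].
have [/eqP->|/eqP nS] := boolP (F == star n r).
  by right; rewrite h3 -{1}[hit X _]addn0 ltn_add2l.
have [/eqP->|/eqP n3] := boolP (F == AHM n r 3); [by left | right].
have cX : #|X| = 1 by rewrite cards1.
apply: leq_ltn_trans (hit_upper MF nS n3 r3 rn3 sX) _; rewrite h3.
have r1 : 1 <= 2 * r by clear -r3; lia.
have kn : 1 < n by clear -n11 r3; lia.
have cw : 'C(#|X :|: itv n 1 (2 * r)|, 3) <= 'C(4 * r, 3).
  by apply: card_window; rewrite ?cX.
(* The value [k = 2] counts one leading term from the star and one, up to [bin_drop], from the gain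
   C(n-3, r-2). *)
apply: (@leading_term_wins _ _ _ _ _ 2 _ _ (bin_dominates r3 rn) _ cw).
- rewrite ltnS -cX; apply/subset_leq_card/subsetP => y.
  by rewrite inE => /andP[].
- by clear -r3; nia.
have := @hit_star_lower n r 1 X r3 n1 kn sX; rewrite cX => /(_ isT).
have := bin_drop n 1 r3.
have -> : n - 2 - 1 = n - 3 by clear; lia.
have -> : r.+1 - 3 = r - 2 by clear; lia.
by clear; lia.
Qed.

(** Any further family not below the star is full up to [m], hence bounded by [AHM n r m]. The gain
    of the latter is smaller than that of [AHM n r 3] when [m > 4], and equal to it when [m] is 3 or
    4. *)
Lemma optimal_mostly_23 n r (X : {set 'I_n.+1}) (m := \max_(i in X) i) :
  3 <= r -> threshold r <= n -> X \subset itv n 2 n -> X :&: itv n 2 3 != set0 ->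
  #|X :\: itv n 2 3| <= 1 -> 3 <= m ->
  forall F, optimal r X F <-> F = AHM n r 3 \/ (m = 4 /\ F = AHM n r 4).
Proof.
move=> r3 rn sX X23 cX m3; have n11 := threshold_ge rn.
have rn2 : 2 * r <= n by lia.
have X0 : X != set0 by apply: contraNneq X23 => ->; rewrite set0I.
have sXm := sub_itv_max sX; rewrite -/m in sXm.
have [x xX mx] := max_mem X0; rewrite -/m in mx.
have MH t : 3 <= t <= 4 -> MLCIF r (AHM n r t).
  by move=> t34; apply: AHM_MLCIF => //; clear -t34 r3; lia.
have e0 t : t <= r.+1 -> 0 < 'C(n - t, r.+1 - t).
  by move=> tr; rewrite bin_gt0; clear -tr n11 r3; lia.
have hm t : 3 <= t <= r.+1 -> t = m ->
    hit X (AHM n r t) = hit X (star n r) + 'C(n - t, r.+1 - t).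
  by move=> tr tm; apply: hit_AHM_max; rewrite ?tm // -?tm; clear -tr n11; lia.
(* The minimum covers two cases: [m = 3], with no point beyond 3, and one point beyond 3, whose
   position does not affect the gain. *)
have h3 : hit X (AHM n r 3) =
    hit X (star n r) + 'C(n - minn m 4, r.+1 - minn m 4).
  have [m_le3|m_gt3] := leqP m 3.
    have em : m = 3 by apply/eqP; rewrite eqn_leq m_le3.
    by rewrite em hm //; clear -r3; lia.
  have xY : x \in X :\: itv n 2 3.
    by rewrite in_setD xX inE -mx; clear -m_gt3; lia.
  rewrite (minn_idPr m_gt3); apply: (@hit_AHM3_one n r x) => //.
    by clear -r3 n11; lia.
  by apply/esym/eqP; rewrite eqEcard sub1set xY cards1.
apply: (@optimal_iff _ _ X _ (AHM n r 3) (hit X (AHM n r 3))); first by left.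
  move=> F [->|[m4 ->]]; first by split=> //; apply: MH.
  split; first exact: MH.
  by rewrite h3 m4 hm.
move=> F MF.
have lt_star : hit X (star n r) < hit X (AHM n r 3).
  rewrite h3 -{1}[hit X _]addn0 ltn_add2l; apply: e0.
  by clear -r3; lia.
have [/eqP->|/eqP nS] := boolP (F == star n r); first by right.
have [/eqP->|/eqP n3] := boolP (F == AHM n r 3); first by left; left.
have [hF|fm] := nonstar_dichotomy r3 rn X0 sX MF nS n3.
  by right; apply: ltn_trans lt_star.
rewrite -/m in fm.
have mn : m <= n by rewrite mx -ltnS ltn_ord.
have mr : m <= r.+1.
  by apply: (nonstar_full_upto_le MF nS _ rn2 mn fm); clear -r3; lia.
have m3r : 3 <= m <= r.+1 by rewrite m3.
have hF := full_hit r3 rn2 m3r X0 sXm MF fm.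
have [m_le4|m_gt4] := leqP m 4; last first.
  right; apply: (@leq_ltn_trans (hit X (AHM n r m))).
    by case: hF => [<-|/ltnW].
  rewrite h3 hm // ltn_add2l (minn_idPr (ltnW m_gt4)).
  by apply: bin_diag_lt; rewrite ?m_gt4 //; clear -r3 n11; lia.
have eh : hit X (AHM n r m) = hit X (AHM n r 3) by rewrite h3 hm // (minn_idPl _).
case: hF => [eF|]; last by rewrite eh; right.
have [m4|m_neq4] := eqVneq m 4; first by left; right; rewrite -m4.
have em : m = 3 by clear -m_neq4 m_le4 m3; lia.
by left; left; rewrite -em.
Qed.

Lemma optimal_AHM_max n r (X : {set 'I_n.+1}) (m := \max_(i in X) i) :
  3 <= r -> threshold r <= n -> X != set0 -> X \subset itv n 2 n ->
  3 <= m <= r.+1 -> hit X (AHM n r 3) < hit X (star n r) ->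
  forall F, optimal r X F <-> F = AHM n r m.
Proof.
move=> r3 rn X0 sX mr lt3; have n11 := threshold_ge rn.
have rn2 : 2 * r <= n by lia.
have sXm := sub_itv_max sX; rewrite -/m in sXm.
have hm : hit X (AHM n r m) = hit X (star n r) + 'C(n - m, r.+1 - m).
  by apply: hit_AHM_max => //; clear -mr n11; lia.
have lt_star : hit X (star n r) < hit X (AHM n r m).
  by rewrite hm -{1}[hit X _]addn0 ltn_add2l bin_gt0; clear -mr r3 n11; lia.
apply: (@optimal_iff _ _ X _ (AHM n r m) (hit X (AHM n r m))) => // [F ->|F MF].
  by split=> //; apply: AHM_MLCIF.
have [/eqP->|/eqP nS] := boolP (F == star n r); first by right.
have [/eqP->|/eqP n3] := boolP (F == AHM n r 3).
  by right; apply: ltn_trans lt_star.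
have [hF|fm] := nonstar_dichotomy r3 rn X0 sX MF nS n3.
  by right; apply: ltn_trans lt_star.
exact: full_hit.
Qed.

(** Fullness up to the maximum of [X] is impossible beyond [r.+1], so the dichotomy leaves every
    other family below the star. *)
Lemma optimal_star n r (X : {set 'I_n.+1}) :
  3 <= r -> threshold r <= n -> X != set0 -> X \subset itv n 2 n ->
  r.+1 < \max_(i in X) i -> hit X (AHM n r 3) < hit X (star n r) ->
  forall F, optimal r X F <-> F = star n r.
Proof.
move=> r3 rn X0 sX mr lt3; have n11 := threshold_ge rn.
have rn2 : 2 * r <= n by lia.
apply: (@optimal_iff _ _ X _ (star n r) (hit X (star n r))) => // [F ->|F MF].
  by split=> //; apply: star_MLCIF => //; clear -r3; lia.
have [/eqP->|/eqP nS] := boolP (F == star n r); first by left.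
have [/eqP->|/eqP n3] := boolP (F == AHM n r 3); first by right.
have [hF|fm] := nonstar_dichotomy r3 rn X0 sX MF nS n3; first by right.
have mn : \max_(i in X) i <= n.
  by have [x _ ->] := max_mem X0; rewrite -ltnS ltn_ord.
have r2 : 2 <= r by apply: ltnW.
by have := nonstar_full_upto_le MF nS r2 rn2 mn fm; rewrite leqNgt mr.
Qed.

(** * Position of [X] relative to [{2, 3}] and the final case analysis *)

Lemma itv23 n : 3 <= n -> itv n 2 3 = [set inord 2; inord 3].
Proof.
by move=> n3; apply/setP => i; rewrite !inE !eq_inord //; lia.
Qed.

(** The cases of the theorem are regrouped by how [AHM n r 3] compares with the star: it beats the
    star in the first two and loses in the third. *)
Variant position n r (X : {set 'I_n.+1}) : Prop :=
  | OnlyTwo of X = [set inord 2]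
  | Mostly23 of X :&: itv n 2 3 != set0 & #|X :\: itv n 2 3| <= 1
              & 3 <= \max_(i in X) i
  | Away23 of hit X (AHM n r 3) < hit X (star n r) & 3 <= \max_(i in X) i.

Lemma positionP n r (X : {set 'I_n.+1}) : 3 <= r -> threshold r <= n ->
  X != set0 -> X \subset itv n 2 n -> position r X.
Proof.
move=> r3 /threshold_ge n11 X0 sX.
have [n3 rn] : 3 <= n /\ 4 * r + r <= n by lia.
have ge4 y : y \in X :\: itv n 2 3 -> 4 <= y.
  by rewrite in_setD => /andP[+ /(subsetP sX)]; rewrite !inE; clear; lia.
have m3 y : y \in X :\: itv n 2 3 -> 3 <= \max_(i in X) i.
  move=> yY; apply: leq_trans (ltnW (ge4 y yY)) (leq_bigmax_cond _ _).
  by move: yY; rewrite in_setD => /andP[].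
have [far|cY] := ltnP 1 #|X :\: itv n 2 3|.
  have [y yY] := card_gt0P (ltnW far).
  by apply: Away23 (m3 y yY); apply: hit_AHM3_two.
have [X23|X23] := eqVneq (X :&: itv n 2 3) set0.
  have eX : X :\: itv n 2 3 = X by apply/setDidPl; rewrite -setI_eq0 X23.
  have /cards1P[y ey] : #|X| == 1 by rewrite eqn_leq -{1}eX cY card_gt0.
  have yY : y \in X :\: itv n 2 3 by rewrite eX ey set11.
  by apply: Away23 (m3 y yY); rewrite ey; apply: hit_AHM3_single (ge4 y yY).
have [|m2] := leqP 3 (\max_(i in X) i); first exact: Mostly23.
have [x xX mx] := max_mem X0.
have eX i : i \in X -> i = inord 2.
  move=> iX; apply/eqP; rewrite eq_inord; last by clear -n3; lia.
  by have := subsetP (sub_itv_max sX) _ iX; rewrite inE; clear -m2; lia.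
apply: OnlyTwo; apply/eqP; rewrite eqEsubset sub1set -{2}(eX x xX) xX andbT.
by apply/subsetP => i /eX ->; rewrite set11.
Qed.

(** A point beyond 3, together with one or both of 2 and 3, would make [X] an instance of (b) or
    (c). *)
Lemma Mostly23_exceptional n (X : {set 'I_n.+1}) : 3 <= n ->
  X :&: itv n 2 3 != set0 -> #|X :\: itv n 2 3| <= 1 ->
  ~ case_b X -> ~ case_c X -> X \subset itv n 2 3.
Proof.
move=> n3 X23 cY nb nc; rewrite -setD_eq0 -cards_eq0; apply/negPn/negP => Y0.
have {}cY : #|X :\: itv n 2 3| = 1 by apply/eqP; rewrite eqn_leq cY lt0n.
have cX := cardsID (itv n 2 3) X.
have c23 : #|itv n 2 3| = 2 by rewrite card_itv.
have [c1|c1] := leqP #|X :&: itv n 2 3| 1.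
  apply: nb; split; last by rewrite -itv23.
  by move: X23; rewrite -card_gt0 -cX cY => ?; lia.
have s23 : itv n 2 3 \subset X.
  by apply/setIidPr/eqP; rewrite eqEcard subsetIr c23.
apply: nc; split; last by rewrite -itv23.
by rewrite -cX cY (setIidPr s23) c23.
Qed.

(** If 4 is in [X], the maximum is at least 4; a larger maximum would be a second point beyond 3. *)
Lemma Mostly23_max4 n (X : {set 'I_n.+1}) : 4 <= n ->
  X != set0 -> #|X :\: itv n 2 3| <= 1 ->
  \max_(i in X) i = 4 <-> inord 4 \in X.
Proof.
move=> n4 X0 cY; have [x xX mx] := max_mem X0; rewrite mx; split=> [x4|X4].
  by rewrite -x4 inord_val.
have x4 : 4 <= x by rewrite -mx -[4](@inordK n 4) //; apply: leq_bigmax_cond.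
apply/eqP; rewrite -eq_inord //; apply: contraLR cY => x_neq4.
rewrite -ltnNge; apply/card_gt1P; exists x, (inord 4).
by rewrite !in_setD xX X4 !inE inordK //; split=> //; lia.
Qed.

Theorem theorem1p5 (r : nat) (hr : 3 <= r) :
  exists n0 : nat, forall n : nat, n0 <= n ->
  forall X : {set 'I_n.+1}, X != set0 -> X \subset itv n 2 n ->
  [/\ case_a X ->
        forall F, optimal r X F <-> F = AHM n r 3,
      case_b X ->
        forall F, optimal r X F <->
          F = AHM n r 3 \/ (inord 4 \in X /\ F = AHM n r 4),
      case_c X ->
        forall F, optimal r X F <->
          F = AHM n r 3 \/
          (X = [set inord 2; inord 3; inord 4] /\ F = AHM n r 4),
      case_d r X ->
        forall F, optimal r X F <-> F = AHM n r (\max_(i in X) i)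
    & ~ (case_a X \/ case_b X \/ case_c X \/ case_d r X) ->
        forall F, optimal r X F <-> F = star n r].
Proof.
exists (threshold r) => n rn X X0 sX; have n11 := threshold_ge rn.
have [n3 n4] : 3 <= n /\ 4 <= n by lia.
have e23 := itv23 n3; have c23 : #|itv n 2 3| = 2 by rewrite card_itv.
have cX := cardsID (itv n 2 3) X.
have sXm := sub_itv_max sX.
have max_le k : \max_(i in X) i <= k -> X \subset itv n 2 k.
  by move=> mk; apply: subset_trans sXm (itvS _ (leqnn 2) mk).
split.
- by move->; apply: optimal_2.
- case=> cX2; rewrite -e23 => X23.
  have cY : #|X :\: itv n 2 3| <= 1.
    by move: X23 cX; rewrite cX2 -card_gt0; clear; lia.
  have m3 : 3 <= \max_(i in X) i.
    rewrite leqNgt; apply/negP => /max_le/subset_leq_card.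
    by rewrite cX2 card_itv //; apply: ltnW (ltnW n4).
  move=> F; have [e1 e2] := Mostly23_max4 n4 X0 cY.
  apply: iff_trans (optimal_mostly_23 hr rn sX X23 cY m3 F) _.
  split=> -[?|[]]; try by left.
    by move=> /e1 ? ?; right.
  by move=> /e2 ? ?; right.
- case=> cX3; rewrite -e23 => s23.
  have X23 : X :&: itv n 2 3 != set0.
    by rewrite -card_gt0 (setIidPr s23) c23.
  have cY : #|X :\: itv n 2 3| <= 1.
    by move: cX; rewrite (setIidPr s23) c23 cX3; clear; lia.
  have m3 : 3 <= \max_(i in X) i.
    rewrite -[3](@inordK n 3) //; apply: leq_bigmax_cond; apply: (subsetP s23).
    by rewrite e23 !inE eqxx orbT.
  move=> F; have [e1 e2] := Mostly23_max4 n4 X0 cY.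
  apply: iff_trans (optimal_mostly_23 hr rn sX X23 cY m3 F) _.
  have e4 : inord 4 \in X <-> X = itv n 2 3 :|: [set inord 4].
    split=> [X4|->]; last by rewrite !inE eqxx orbT.
    apply/esym/eqP; rewrite eqEcard cX3 subUset s23 sub1set X4 /=.
    by rewrite setUC cardsU1 c23 inE inordK.
  split=> -[?|[]]; try by left.
    by move=> /e1/e4 ? ?; right.
  by move=> /e4/e2 ? ?; right.
(* In the [Mostly23] position only [X = {3}] survives the exclusions; its maximum is 3, so the
   alternative [AHM n r 4] is void. *)
- case=> sXr na nb nc; have [/na //|X23 cY m3|lt3 m3] := positionP hr rn X0 sX.
    have s23 := Mostly23_exceptional n3 X23 cY nb nc.
    have em : \max_(i in X) i = 3.
      apply/eqP; rewrite eqn_leq m3 andbT; apply/bigmax_leqP => i /(subsetP s23).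
      by rewrite inE => /andP[].
    move=> F; apply: iff_trans (optimal_mostly_23 hr rn sX X23 cY m3 F) _.
    by rewrite em; split=> [[//|[]]|->]; [|left].
  apply: optimal_AHM_max => //; rewrite m3; apply/bigmax_leqP => i.
  by move/(subsetP sXr); rewrite inE => /andP[].
- move=> nabcd.
  have na : ~ case_a X by move=> h; apply: nabcd; left.
  have nb : ~ case_b X by move=> h; apply: nabcd; right; left.
  have nc : ~ case_c X by move=> h; apply: nabcd; do 2 right; left.
  have nd : ~ X \subset itv n 2 r.+1.
    by move=> h; apply: nabcd; do 3 right; split.
  (* The [Mostly23] position would put [X] inside [[2, 3]], hence inside [[2, r+1]]; only sets on
     which [AHM n r 3] loses to the star remain. *)
  have [/na //|X23 cY m3|lt3 m3] := positionP hr rn X0 sX.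
    have s23 := Mostly23_exceptional n3 X23 cY nb nc.
    by case: nd; apply: subset_trans s23 (itvS _ _ (leqW hr)).
  by apply: optimal_star => //; rewrite ltnNge; apply/negP => /max_le.
Qed.
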